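(* Let $H=(V,E)$ be a connected finite hypergraph with associated symmetric directed hyperedge set $\vec E$, vertex measure $\mu$ and hyperedge weight $\omega$. There is a divergence operator $\mathrm{div}:\mathcal{H}(\vec E)\to L^2(V)$ satisfying $$\langle\nabla\psi,\phi\rangle_{\vec E}=\langle\psi,-\mathrm{div}\,\phi\rangle_V\qquad\text{for all }\psi\in L^2(V),\ \phi\in\mathcal{H}(\vec E).$$ Moreover, this identity determines the operator $\mathrm{div}$ uniquely, and it is given, for $\phi\in\mathcal H(\vec E)$ and $v\in V$, by $$\mathrm{div}\,\phi(v)=-\frac{1}{\mu(v)}\sum_{\vec e\in\vec E:\,v\in\vec e}\frac{\sqrt{\omega_{\vec e}}}{\delta_{\vec e}!\sqrt{\delta_{\vec e}-1}}\phi(\vec e)+\frac{1}{\mu(v)}\sum_{\vec e\in\vec E:\,\vec e(1)=v}\frac{\delta_{\vec e}\sqrt{\omega_{\vec e}}}{\delta_{\vec e}!\sqrt{\delta_{\vec e}-1}}\phi(\vec e).$$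
   Context: A (finite, undirected) hypergraph $H=(V,E)$ consists of a finite vertex set $V$ and a set $E$ of hyperedges, each hyperedge $e\in E$ being a subset of $V$ with cardinality $\delta_e:=|e|$ satisfying $2\le\delta_e\le|V|$. $H$ is connected if for any two different vertices $v,v'$ there is a sequence of hyperedges $e_1,\dots,e_l\in E$ with $v\in e_1$, $v'\in e_l$ and $e_n\cap e_{n+1}\ne\emptyset$ for $1\le n\le l-1$. The corresponding symmetric directed hyperedge set $\vec E$ consists of all orderings of all hyperedges: each $e\in E$ gives rise to exactly $\delta_e!$ directed hyperedges $\vec e$, one for each linear ordering of the vertices of $e$; $\vec e(1)$ denotes the first vertex of $\vec e$, and $v\in\vec e$ means $v\in e$. The measure is $\mu:V\to(0,\infty)$, the weight is $\omega:E\to(0,\infty)$, and for a directed hyperedge $\vec e$ arising from $e$ one sets $\omega_{\vec e}=\omega_e=\omega(e)$, $\delta_{\vec e}=\delta_e$. $L^2(V)$ is the space of functions $V\to\mathbb{R}$ with inner product $\langle\phi,\psi\rangle_V=\sum_{v\in V}\mu(v)\phi(v)\psi(v)$; $\mathcal{H}(\vec E)$ is the space of functions $\vec E\to\mathbb{R}$ with inner product $\langle\phi,\psi\rangle_{\vec E}=\sum_{\vec e\in\vec E}\frac{1}{\delta_{\vec e}!}\phi(\vec e)\psi(\vec e)$. The gradient $\nabla:L^2(V)\to\mathcal{H}(\vec E)$ is $$\nabla\phi(\vec e)=\sqrt{\frac{\omega_{\vec e}}{\delta_{\vec e}-1}}\sum_{u\in\vec e}(\phi(u)-\phi(\vec e(1))).$$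 *)

(* Defs.v *)
From HB Require Import structures.
From mathcomp Require Import all_boot all_order all_algebra.
From mathcomp Require Import reals.

Set Implicit Arguments.
Unset Strict Implicit.
Unset Printing Implicit Defensive.
Import Order.TTheory GRing.Theory Num.Theory.
Local Open Scope ring_scope.

(* The upper bound #|e| <= #|V| is automatic for subsets of V (max_card). *)
Record hypergraph (V : finType) := Hypergraph {
  hyperedges : {set {set V}};
  hyperedge_card_ge2 : forall e, e \in hyperedges -> (2 <= #|e|)%N
}.

Definition hconnected (V : finType) (H : hypergraph V) : Prop :=
  forall v v' : V, v != v' ->
  exists (e1 : {set V}) (es : seq {set V}),
    [/\ {subset e1 :: es <= hyperedges H},
        path (fun e e' : {set V} => e :&: e' != set0) e1 es,
        v \in e1 & v' \in last e1 es].

Section DirectedHyperedges.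
Variables (V : finType) (H : hypergraph V).

Definition orderings : seq (seq V) :=
  [seq s | e : {set V} <- enum (hyperedges H),
           s : seq V <- permutations (enum e)].

(* A directed hyperedge is a duplicate-free sequence whose set of entries is a
   hyperedge (mem_orderings); each hyperedge e has exactly #|e|`! of them
   (card_dhyperedges). *)
Definition dhyperedge : Type := seq_sub orderings.

HB.instance Definition _ := Finite.copy dhyperedge (seq_sub orderings).

Implicit Type a : dhyperedge.

Definition dverts a : {set V} := [set x in val a].

Definition delta a : nat := #|dverts a|.

Lemma mem_orderings s :
  (s \in orderings) = uniq s && ([set x in s] \in hyperedges H).
Proof.
apply/allpairsPdep/andP => [[e [t [eH]]]|[us sH]].
  rewrite mem_permutations mem_enum in eH * => pt ->.
  have -> : [set x in t] = e.
    by apply/setP=> x; rewrite inE (perm_mem pt) mem_enum.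
  by rewrite (perm_uniq pt) enum_uniq.
exists [set x in s], s; split=> //; first by rewrite mem_enum.
rewrite mem_permutations uniq_perm ?enum_uniq // => x.
by rewrite mem_enum inE.
Qed.

Lemma dhyperedge_uniq a : uniq (val a).
Proof. by have := valP a; rewrite mem_orderings => /andP[]. Qed.

Lemma dverts_in a : dverts a \in hyperedges H.
Proof. by have := valP a; rewrite mem_orderings => /andP[]. Qed.

Lemma delta_size a : delta a = size (val a).
Proof. by rewrite /delta /dverts cardsE; apply/card_uniqP/dhyperedge_uniq. Qed.

Lemma size_dhyperedge_gt0 a : (0 < size (val a))%N.
Proof.
by rewrite -delta_size; apply: leq_trans (hyperedge_card_ge2 (dverts_in a)).
Qed.

Definition first a : V :=
  match val a as s return (0 < size s)%N -> V with
  | [::] => fun s_gt0 => False_rect V (notF s_gt0)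
  | x :: _ => fun=> x
  end (size_dhyperedge_gt0 a).

Lemma dhyperedgeE a : val a = first a :: behead (val a).
Proof.
rewrite /first; move: (size_dhyperedge_gt0 a).
by case: (val a).
Qed.

Lemma card_dhyperedges (e : {set V}) : e \in hyperedges H ->
  #|[set a | dverts a == e]| = (#|e|)`!.
Proof.
move=> eH; rewrite cardE -(size_map val) [in RHS]cardE.
rewrite -size_permutations ?enum_uniq //; apply/perm_size/uniq_perm.
- by rewrite (map_inj_uniq val_inj) enum_uniq.
- exact: permutations_uniq.
move=> s; rewrite mem_permutations; apply/mapP/idP.
  case=> a; rewrite mem_enum inE => /eqP <- ->.
  apply: uniq_perm; rewrite ?enum_uniq ?dhyperedge_uniq // => x.
  by rewrite mem_enum inE.
move=> ps; have es : [set x in s] = e.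
  by apply/setP=> x; rewrite inE (perm_mem ps) mem_enum.
have so : s \in orderings.
  by rewrite mem_orderings (perm_uniq ps) enum_uniq es.
by exists (SeqSub so); rewrite // mem_enum inE /dverts /= es.
Qed.

End DirectedHyperedges.

Section Gradient.
Variables (R : realType) (V : finType) (H : hypergraph V).
(* Only the values of omega on hyperedges are ever used. *)
Variables (mu : V -> R) (omega : {set V} -> R).

Definition innerV (phi psi : {ffun V -> R}) : R :=
  \sum_(v : V) mu v * phi v * psi v.

Definition innerE (phi psi : {ffun dhyperedge H -> R}) : R :=
  \sum_(a : dhyperedge H) (delta a)`!%:R^-1 * phi a * psi a.

Definition grad (phi : {ffun V -> R}) : {ffun dhyperedge H -> R} :=
  [ffun a => Num.sqrt (omega (dverts a) / ((delta a)%:R - 1))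
             * \sum_(u in dverts a) (phi u - phi (first a))].

Definition is_divergence
    (div : {ffun dhyperedge H -> R} -> {ffun V -> R}) : Prop :=
  forall (psi : {ffun V -> R}) (phi : {ffun dhyperedge H -> R}),
    innerE (grad psi) phi = innerV psi (- div phi).

End Gradient.

(* Main.v *)
Require Import Defs.
From mathcomp Require Import all_boot all_order all_algebra.
From mathcomp Require Import reals.

Set Implicit Arguments.
Unset Strict Implicit.
Unset Printing Implicit Defensive.
Import Order.TTheory GRing.Theory Num.Theory.
Local Open Scope ring_scope.

(** The gradient is linear and all the spaces are finite dimensional, so the
divergence is minus the adjoint of the gradient.  To find it, write the
[a]-summand of the edge product of [grad psi] and [phi] as the product of
[c_a = edge_weight a], of [phi a] and of
<<
  \sum_(u in a) (psi u - psi (first a))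
    = \sum_(u in a) psi u - delta a * psi (first a)
>>
and collect the terms by vertex instead of by hyperedge: [psi v] receives
[c_a * phi a] from each [a] containing [v], and [- delta a * c_a * phi a] from
each [a] starting at [v] ([innerE_grad]).  Dividing by [- mu v] gives the stated
formula.  Uniqueness holds because a vertex function is determined by its
products with the indicators of single vertices, [mu] having no zero
([innerV_inj]). *)

Section Divergence.
Variables (R : realType) (V : finType) (H : hypergraph V).
Variables (mu : V -> R) (omega : {set V} -> R).

Implicit Types (psi f g : {ffun V -> R}) (phi : {ffun dhyperedge H -> R}).
Implicit Types (a : dhyperedge H) (v : V).

(** Absorbs both the normalisation of the gradient and the factor
[1 / (delta a)!] of the edge product. *)
Definition edge_weight a : R :=
  Num.sqrt (omega (dverts a)) / ((delta a)`!%:R * Num.sqrt ((delta a)%:R - 1)).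

Definition divergence phi : {ffun V -> R} :=
  [ffun v => - ((mu v)^-1 * \sum_(a : dhyperedge H | v \in dverts a)
                   edge_weight a * phi a)
             + (mu v)^-1 * \sum_(a : dhyperedge H | first a == v)
                   (delta a)%:R * edge_weight a * phi a].

Lemma edge_weightE a :
  (delta a)`!%:R^-1 * Num.sqrt (omega (dverts a) / ((delta a)%:R - 1))
  = edge_weight a.
Proof.
have delta_ge1 : 0 <= (delta a)%:R - 1 :> R.
  by rewrite subr_ge0 ler1n (ltnW (hyperedge_card_ge2 (dverts_in a))).
rewrite /edge_weight [omega _ / _]mulrC sqrtrM ?invr_ge0 // sqrtrV // invfM.
by rewrite mulrA mulrC.
Qed.

Lemma sum_grad psi a :
  \sum_(u in dverts a) (psi u - psi (first a))
  = \sum_(u in dverts a) psi u - (delta a)%:R * psi (first a).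
Proof. by rewrite sumrB sumr_const mulr_natl. Qed.

(** Summation by parts: exchanging the sums over hyperedges and vertices makes
[psi] appear undifferentiated. *)
Lemma innerE_grad psi phi :
  innerE (grad H omega psi) phi
  = \sum_v psi v *
      (\sum_(a : dhyperedge H | v \in dverts a) edge_weight a * phi a
       - \sum_(a : dhyperedge H | first a == v)
           (delta a)%:R * edge_weight a * phi a).
Proof.
under [RHS]eq_bigr => v _ do rewrite mulrBr !mulr_sumr.
rewrite sumrB (exchange_big_dep predT) //=.
rewrite [in X in _ - X](exchange_big_dep predT) //= -sumrB.
apply: eq_bigr => a _.
rewrite [X in _ - X](big_pred1 (first a)) => [|v]; last by rewrite /= eq_sym.
rewrite ffunE mulrA edge_weightE sum_grad -mulr_suml mulrBr mulrBl.
congr (_ - _); first by rewrite mulrAC mulrC.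
by rewrite mulrA [edge_weight a * _]mulrC mulrAC [RHS]mulrC.
Qed.

(** The indicators of single vertices separate vertex functions. *)
Lemma innerV_inj f g : (forall v, mu v != 0) ->
  (forall psi, innerV mu psi f = innerV mu psi g) -> f = g.
Proof.
have innerV_indicator h v : innerV mu [ffun u => (u == v)%:R] h = mu v * h v.
  rewrite /innerV (bigD1 v) //= big1 => [|u /negPf uv].
    by rewrite ffunE eqxx mulr1 addr0.
  by rewrite ffunE uv mulr0 mul0r.
move=> mu_neq0 fg; apply/ffunP => v; have := fg [ffun u => (u == v)%:R].
by rewrite !innerV_indicator => /(mulfI (mu_neq0 v)).
Qed.

Lemma divergenceP : (forall v, mu v != 0) -> is_divergence mu omega divergence.
Proof.
move=> mu_neq0 psi phi; rewrite innerE_grad; apply: eq_bigr => v _.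
rewrite !ffunE -mulrN -mulrDr -mulrN opprD opprK.
by rewrite [mu v * _]mulrC -mulrA mulVKf.
Qed.

Lemma is_divergence_unique div1 div2 : (forall v, mu v != 0) ->
  is_divergence (H := H) mu omega div1 -> is_divergence mu omega div2 ->
  forall phi, div1 phi = div2 phi.
Proof.
move=> mu_neq0 div1P div2P phi; apply/oppr_inj/(innerV_inj mu_neq0) => psi.
by rewrite -div1P div2P.
Qed.

End Divergence.

Theorem lemma2p2 (R : realType) (V : finType) (H : hypergraph V)
    (mu : V -> R) (omega : {set V} -> R)
    (H_connected : hconnected H)
    (mu_gt0 : forall v : V, 0 < mu v)
    (omega_gt0 : forall e : {set V}, e \in hyperedges H -> 0 < omega e) :
  exists div : {ffun dhyperedge H -> R} -> {ffun V -> R},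
    [/\ is_divergence mu omega div,
        forall div' : {ffun dhyperedge H -> R} -> {ffun V -> R},
          is_divergence mu omega div' -> forall phi, div' phi = div phi
      & forall (phi : {ffun dhyperedge H -> R}) (v : V),
          div phi v =
            - ((mu v)^-1 * \sum_(a : dhyperedge H | v \in dverts a)
                 Num.sqrt (omega (dverts a))
                 / ((delta a)`!%:R * Num.sqrt ((delta a)%:R - 1)) * phi a)
            + (mu v)^-1 * \sum_(a : dhyperedge H | first a == v)
                 (delta a)%:R * Num.sqrt (omega (dverts a))
                 / ((delta a)`!%:R * Num.sqrt ((delta a)%:R - 1)) * phi a].
Proof.
have mu_neq0 v : mu v != 0 by exact/lt0r_neq0/mu_gt0.
exists (divergence mu omega); split.
- exact: divergenceP.
- move=> div' div'P.
  exact: is_divergence_unique mu_neq0 div'P (divergenceP omega mu_neq0).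
move=> phi v; rewrite ffunE; congr (_ + _ * _).
by apply: eq_bigr => a _; rewrite /edge_weight mulrA.
Qed.
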